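(* There is an absolute constant $C$ such that the following holds. Let $F : \mathbf{N} \rightarrow \mathbf{C}$ be any function. Let $1 < Y < Z < X^{1/16}$ be parameters with $\frac{\log Z}{\log Y} \geqslant 2$. Let $f : \mathbf{N} \rightarrow \mathbf{C}$ be a multiplicative function with $|f(n)| \leqslant 1$ for all $n$. Then \[ \big| \mathbb{E}_{n \leqslant X} f(n) F(n) \big| \leqslant C\,( E_{\mathrm{triv}} + E_{\mathrm{sieve}} + E_{\mathrm{bilinear}} ),\] where \[ E_{\mathrm{triv}} := Y^{-1/2}\Vert F \Vert_{\infty} ,\] \[ E_{\mathrm{sieve}} := \mathbb{E}_{n \leqslant X}|F(n)|\,1_{(n,\prod_{Y \leqslant p < Z} p) = 1},\] and \[ E_{\mathrm{bilinear}} := \sqrt{\sup_{p,p', I} \frac{1}{\max(I)}\Big|\sum_{\substack{m \in I\\ (m,pp') = 1}} F(pm) \overline{F(p' m)}\Big|},\] the supremum being taken over all primes $p, p'$ with $Y \leqslant p < p' < Z$ and all intervals $I \subset [0,X]$ with $\max(I) > \frac{X}{10YZ}$.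
   Context: $\mathbb{E}_{n \leqslant X} g(n)$ denotes the average of $g$ over the positive integers $n \leqslant X$. $\mathbf{N}$ is the set of positive integers, and sums over $m \in I$ run over positive integers $m$ in $I$. In the product $\prod_{Y \leqslant p < Z} p$, $p$ runs over primes; $(m,n)$ denotes the greatest common divisor; $1_{P}$ equals $1$ if the condition $P$ holds and $0$ otherwise; $\Vert F\Vert_\infty = \sup_n |F(n)|$. Multiplicative means $f(mn)=f(m)f(n)$ whenever $\gcd(m,n)=1$. *)

(* Defs.v *)
From mathcomp Require Import all_boot all_order all_algebra.
From mathcomp Require Import all_classical all_reals all_analysis.
From mathcomp Require Export complex.

Set Implicit Arguments.
Unset Strict Implicit.
Unset Printing Implicit Defensive.

Import Order.TTheory GRing.Theory Num.Theory.

Local Open Scope classical_set_scope.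
Local Open Scope ring_scope.

(* Functions on the positive integers are represented by functions on [nat];
   their value at 0 is never used. *)

Definition multiplicative_fun (K : nzRingType) (f : nat -> K) : Prop :=
  forall m n : nat, (0 < m)%N -> (0 < n)%N -> coprime m n ->
    f (m * n)%N = f m * f n.

Definition cmod (R : realType) (z : R[i]) : R := Normc.normc z.

Definition avg (R : realType) (K : fieldType) (X : R) (g : nat -> K) : K :=
  (Num.truncn X)%:R^-1 * \sum_(1 <= n < (Num.truncn X).+1) g n.

Definition sup_norm (R : realType) (F : nat -> R[i]) : \bar R :=
  ereal_sup [set (cmod (F n))%:E | n in [set n : nat | (0 < n)%N]].

Definition prime_prod (R : realType) (Y Z : R) : nat :=
  (\prod_(p < (Num.truncn Z).+1 | prime p && (Y <= p%:R < Z)%R) p)%N.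

Definition E_triv (R : realType) (Y : R) (F : nat -> R[i]) : \bar R :=
  ((Y `^ (- (1 / 2)))%:E * sup_norm F)%E.

Definition E_sieve (R : realType) (X Y Z : R) (F : nat -> R[i]) : R :=
  avg X (fun n => cmod (F n) * (coprime n (prime_prod Y Z))%:R).

(* [M] plays the role of max(I). *)
Definition bilinear_avg (R : realType) (F : nat -> R[i]) (p p' : nat)
    (I : set R) (M : R) : R :=
  M^-1 * cmod (\sum_(1 <= m < (Num.truncn M).+1 |
                       (m%:R \in I) && coprime m (p * p')%N)
                 F (p * m)%N * (F (p' * m)%N)^*).

Definition bilinear_avgs (R : realType) (X Y Z : R) (F : nat -> R[i]) :
    set (\bar R) :=
  [set r | exists (p p' : nat) (I : set R) (M : R),
     [/\ prime p, prime p' &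
         [/\ Y <= p%:R, (p < p')%N & p'%:R < Z]] /\
     [/\ is_interval I, I `<=` `[0, X], I M, ubound I M &
         X / (10 * Y * Z) < M] /\
     r = (bilinear_avg F p p' I M)%:E].

(* When there are no two primes in [Y, Z) the supremum is over the empty set
   and [sqrte -oo] is 0, so the convention is that it contributes 0. *)
Definition E_bilinear (R : realType) (X Y Z : R) (F : nat -> R[i]) : \bar R :=
  sqrte (ereal_sup (bilinear_avgs X Y Z F)).

(* Main.v *)
Require Import Defs.
From mathcomp Require Import all_boot all_order all_algebra.
From mathcomp Require Import all_classical all_reals all_analysis.
From mathcomp Require Import complex.
From mathcomp Require Import ring lra zify.

Set Implicit Arguments.
Unset Strict Implicit.
Unset Printing Implicit Defensive.

Import Order.TTheory GRing.Theory Num.Theory.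
Local Open Scope ring_scope.

(* Let S be the set of primes in [Y, Z), omega n the number of p in S dividing
   n, and L the sum of 1/p over S. The n with omega n = 0 contribute the sieve
   term. Any other n is written omega n times as p m with p in S, so its weight
   1 spreads over these factorisations with weight 1 / omega (p m), which is
   1 / (1 + omega m) unless p divides m; the exceptions cost the sum of 1/p^2.
   The rest is cut into dyadic ranges of p, and Cauchy-Schwarz in m bounds each
   range P <= p < 2P by (X/P) W (sqrt k B + k b), with k the number of primes
   in the range, B = sup |F|, b the bilinear term, and W^2 the mean of
   (1 + omega m)^-2. As the sum of k/P is at most 2L, it remains to see that
   W is O(1/L). A variance bound for omega would only give W = O(L^(-1/2));
   the fourth central moment of omega gives O(1/L). Neither Chebyshev's nor
   Mertens' estimates are used: only the same L appears on both sides. *)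

(** * Fourth moment of the number of prime divisors *)

(** Removing a full period does not change the sum, so by strong induction [M] may be taken at most
    [Q], where the trivial bound applies. *)
Lemma sum_periodic_le (R : realFieldType) (Q : nat) (g : nat -> R) (M : nat) :
  (0 < Q)%N -> (forall m, g (m + Q)%N = g m) -> (forall m, `|g m| <= 1) ->
  \sum_(0 <= m < Q) g m = 0 -> `|\sum_(0 <= m < M) g m| <= Q%:R.
Proof.
move=> Q0 gQ g1 g0; elim/ltn_ind: M => M IH.
have [MQ|QM] := leqP M Q.
  apply: le_trans (ler_norm_sum _ _ _) _.
  apply: (@le_trans _ _ (\sum_(0 <= m < M) 1)); first exact: ler_sum.
  by rewrite sumr_const_nat subn0 ler_nat.
rewrite (@big_cat_nat _ _ _ Q) //=; last exact: ltnW.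
rewrite g0 add0r -{1}[Q]add0n big_addn.
under eq_bigr do rewrite gQ.
by apply: IH; lia.
Qed.

(** The multiples of [p] below [p * D] are the [p * j] with [j < D], and multiplication by [p]
    permutes the residues modulo [D]. *)
Lemma sum_dvdn_periodic (R : realFieldType) (p D : nat) (h : nat -> R) :
  (0 < p)%N -> (0 < D)%N -> coprime p D -> (forall m, h (m + D)%N = h m) ->
  \sum_(0 <= m < p * D) (p %| m)%:R * h m = \sum_(0 <= c < D) h c.
Proof.
move=> p0 D0 cop hD.
have hk k m : h (m + k * D)%N = h m.
  by elim: k => [|k IH]; rewrite ?addn0 // mulSn (addnC D) addnA hD.
have hmod m : h (m %% D)%N = h m by rewrite {2}(divn_eq m D) addnC hk.
transitivity (\sum_(0 <= j < D) h (p * j)%N).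
  elim: {hk hmod} D {D0 cop hD} => [|n IH]; first by rewrite muln0 !big_geq.
  rewrite (@big_nat_recr _ _ _ n) //= -IH (@big_cat_nat _ _ _ (p * n)) //=; last by rewrite leq_pmul2l.
  congr (_ + _); rewrite mulnS -{1}[(p * n)%N]add0n big_addn addnK.
  rewrite big_ltn // add0n dvdn_mulr // mul1r big_nat big1 ?addr0 // => i /andP[i0 ip].
  by rewrite dvdn_addl ?dvdn_mulr // gtnNdvd // mul0r.
rewrite !big_mkord.
pose s (j : 'I_D) : 'I_D := Ordinal (ltn_pmod (p * j) D0).
have sI : injective s.
  move=> i j /(congr1 val) /= /eqP; rewrite !(mulnC p).
  wlog ij : i j / (j <= i)%N => [W|].
    by have [/W//|/ltnW/W{}W] := leqP j i; rewrite eq_sym => /W->.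
  rewrite eqn_mod_dvd ?leq_mul2r ?ij ?orbT // -mulnBl Gauss_dvdl ?(coprime_sym D) //.
  move=> Dij; apply/val_inj/eqP; rewrite eqn_leq ij andbT leqNgt -subn_gt0.
  by apply/negP => ij0; have := dvdn_leq ij0 Dij; rewrite leqNgt (leq_ltn_trans (leq_subr _ _) (ltn_ord i)).
by rewrite [RHS](reindex_inj sI) /=; apply: eq_bigr => j _; rewrite hmod.
Qed.

(* The indicator of p | m minus its mean value over m. *)
Definition centered (R : realFieldType) (p m : nat) : R := (p %| m)%:R - p%:R^-1.

Lemma centered_period (R : realFieldType) p D m : (p %| D)%N -> centered R p (m + D) = centered R p m.
Proof. by move=> pD; rewrite /centered dvdn_addl. Qed.

Lemma centered_norm (R : realFieldType) p m : (0 < p)%N -> `|centered R p m| <= 1.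
Proof.
move=> p0; rewrite /centered; have i0 : 0 <= p%:R^-1 :> R by rewrite invr_ge0.
have i1 : p%:R^-1 <= 1 :> R by rewrite invf_le1 ?ltr0n ?ler1n.
by case: (p %| m)%N; rewrite ler_norml ?mulr1n ?mulr0n; apply/andP; split; lra.
Qed.

Lemma centered_sqr (R : realFieldType) p m : (0 < p)%N ->
  centered R p m ^+ 2 <= (p %| m)%:R + p%:R^-1.
Proof.
move=> p0; rewrite /centered; have i0 : 0 <= p%:R^-1 :> R by rewrite invr_ge0.
have i1 : p%:R^-1 <= 1 :> R by rewrite invf_le1 ?ltr0n ?ler1n.
by case: (p %| m)%N; rewrite ?mulr1n ?mulr0n; nra.
Qed.

(** Over a period [p * (q * r * s)], divisibility by [p] is independent of the other three factors,
    because [p] is coprime to [q * r * s], and [centered R p] has mean zero. Only an incomplete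
    period remains. The primes [q], [r], [s] may coincide. *)
Lemma quad_moment_lone (R : realFieldType) (T p q r s M : nat) :
  prime p -> prime q -> prime r -> prime s ->
  (p <= T)%N -> (q <= T)%N -> (r <= T)%N -> (s <= T)%N ->
  p != q -> p != r -> p != s ->
  \sum_(1 <= m < M.+1) centered R p m * centered R q m * centered R r m * centered R s m
    <= 2 * T%:R ^+ 4.
Proof.
move=> pp pq pr ps pT qT rT sT npq npr nps.
have [[[p0 q0] r0] s0] := (prime_gt0 pp, prime_gt0 pq, prime_gt0 pr, prime_gt0 ps).
pose D := (q * r * s)%N.
have D0 : (0 < D)%N by rewrite !muln_gt0 q0 r0.
have cop : coprime p D.
  by rewrite !coprimeMr !prime_coprime // !dvdn_prime2 // npq npr nps.
pose h m : R := centered R q m * centered R r m * centered R s m.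
have hD m : h (m + D)%N = h m.
  have [[qD rD] sD] : (q %| D)%N * (r %| D)%N * (s %| D)%N.
    by split; [split|]; [rewrite !dvdn_mulr | rewrite dvdn_mulr // dvdn_mull | rewrite dvdn_mull].
  by rewrite /h !centered_period.
have hD2 k m : h (m + k * D)%N = h m.
  by elim: k => [|k IH]; rewrite ?addn0 // mulSn (addnC D) addnA hD.
pose g m : R := centered R p m * h m.
have g1 m : `|g m| <= 1.
  by rewrite /g /h !normrM !mulr_ile1 ?mulr_ge0 // ?centered_norm.
have gQ m : g (m + p * D)%N = g m by rewrite /g hD2 centered_period // dvdn_mulr.
have Q0 : (0 < p * D)%N by rewrite muln_gt0 p0.
have g0 : \sum_(0 <= m < p * D) g m = 0.
  rewrite /g /centered; under eq_bigr do rewrite mulrBl.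
  rewrite sumrB sum_dvdn_periodic // -mulr_sumr.
  have -> : \sum_(0 <= m < p * D) h m = p%:R * \sum_(0 <= c < D) h c.
    elim: (p) => [|n IH]; first by rewrite mul0n big_geq // mul0r.
    rewrite (@big_cat_nat _ _ _ (n * D)) //=; last by rewrite leq_mul2r leqnSn orbT.
    rewrite IH -{1}[(n * D)%N]add0n big_addn mulSn addnK.
    under [X in _ + X]eq_bigr do rewrite hD2.
    by rewrite -natr1 mulrDl mul1r.
  by rewrite mulrA mulVf ?mul1r ?subrr // pnatr_eq0 -lt0n.
have := sum_periodic_le M.+1 Q0 gQ g1 g0.
(* The periodic bound starts at m = 0. Dropping that term costs at most 1, hence at most T^4, which
   gives the factor 2. *)
rewrite big_ltn // => H.
have -> : \sum_(1 <= m < M.+1) centered R p m * centered R q m * centered R r m * centered R s m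
    = \sum_(1 <= m < M.+1) g m.
  by apply: eq_bigr => m _; rewrite /g /h !mulrA.
have QT : (p * D)%:R <= T%:R ^+ 4 :> R.
  rewrite -natrX ler_nat /D (_ : (T ^ 4 = T * (T * T * T))%N); last lia.
  by rewrite !leq_mul.
have T1 : 1 <= T%:R ^+ 4 :> R.
  by rewrite -natrX ler1n expn_gt0 (leq_trans p0 pT).
have := g1 0%N; move: H; rewrite !ler_norml; lra.
Qed.

Lemma sum_delta (R : pzRingType) (S : seq nat) (p : nat) (G : nat -> R) :
  uniq S -> p \in S -> \sum_(q <- S) (p == q)%:R * G q = G p.
Proof.
move=> uS pS; rewrite (bigD1_seq p) //= eqxx mul1r big1_seq ?addr0 // => q /andP[qp _].
by rewrite eq_sym (negPf qp) mul0r.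
Qed.

Lemma sum_exp4 (R : comPzRingType) (S : seq nat) (u : nat -> R) :
  (\sum_(p <- S) u p) ^+ 4 =
  \sum_(p <- S) \sum_(q <- S) \sum_(r <- S) \sum_(s <- S) u p * u q * u r * u s.
Proof.
rewrite (_ : forall a : R, a ^+ 4 = a * (a * (a * a))); last first.
  by move=> a; rewrite !exprS expr0 mulr1.
rewrite mulr_suml; apply: eq_bigr => p _; rewrite mulr_suml mulr_sumr.
apply: eq_bigr => q _; rewrite mulr_suml !mulr_sumr; apply: eq_bigr => r _.
by rewrite !mulr_sumr; apply: eq_bigr => s _; rewrite !mulrA.
Qed.

Lemma sum_dvdn (R : realFieldType) (d M : nat) : (0 < d)%N ->
  \sum_(1 <= m < M.+1) (d %| m)%:R <= M%:R / d%:R :> R.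
Proof.
move=> d0; suff -> : \sum_(1 <= m < M.+1) (d %| m)%:R = (M %/ d)%:R :> R.
  by rewrite ler_pdivlMr ?ltr0n // -natrM ler_nat leq_divM.
elim: M => [|M IH]; first by rewrite big_geq // div0n.
by rewrite big_nat_recr //= IH -natrD divnS // addnC.
Qed.

(** The products of four centered indicators without cancellation: two primes, each taken twice. *)
Definition pair_sum (R : realFieldType) (M p q : nat) : R :=
  \sum_(1 <= m < M.+1) centered R p m ^+ 2 * centered R q m ^+ 2.

Lemma pair_sum_ge0 (R : realFieldType) (M p q : nat) : 0 <= pair_sum R M p q.
Proof. by apply: sumr_ge0 => m _; rewrite mulr_ge0 ?sqr_ge0. Qed.

(** Both squares are bounded by [centered_sqr]. For distinct primes the product expands into four
    terms, each of mean at most 1/(pq). For p = q one square is bounded by 1 and the other has mean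
    at most 2/p. *)
Lemma pair_moment (R : realFieldType) (p q M : nat) : prime p -> prime q ->
  pair_sum R M p q <=
  4 * M%:R * (p%:R^-1 * q%:R^-1) + (p == q)%:R * (2 * M%:R * q%:R^-1).
Proof.
move=> pp pq; have [p0 q0] := (prime_gt0 pp, prime_gt0 pq).
have ip : 0 < p%:R^-1 :> R by rewrite invr_gt0 ltr0n.
have iq : 0 < q%:R^-1 :> R by rewrite invr_gt0 ltr0n.
have M0 : 0 <= M%:R :> R by [].
have Mc (c : R) : \sum_(1 <= m < M.+1) c = M%:R * c.
  by rewrite sumr_const_nat subn1 mulr_natl.
have [<-|npq] := eqVneq p q.
  apply: (@le_trans _ _ (\sum_(1 <= m < M.+1) ((p %| m)%:R + p%:R^-1))).
    apply: ler_sum => m _; apply: le_trans (centered_sqr _ _ p0).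
    by rewrite ler_piMr ?sqr_ge0 // -(real_normK (num_real _)) expr_le1 ?centered_norm.
  rewrite big_split /= Mc; have := sum_dvdn R M p0; rewrite mul1r.
  suff : 0 <= 4 * M%:R * (p%:R^-1 * p%:R^-1) :> R by lra.
  by rewrite !mulr_ge0 // ltW.
apply: (@le_trans _ _ (\sum_(1 <= m < M.+1)
    ((p * q %| m)%:R + p%:R^-1 * (q %| m)%:R
     + q%:R^-1 * (p %| m)%:R + p%:R^-1 * q%:R^-1))).
  apply: ler_sum => m _.
  apply: le_trans (ler_pM (sqr_ge0 _) (sqr_ge0 _) (centered_sqr R m p0) (centered_sqr R m q0)) _.
  have cop : coprime p q by rewrite prime_coprime // dvdn_prime2.
  rewrite (Gauss_dvd _ cop).
  by rewrite -mulnb natrM; lra.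
rewrite !big_split /= -!mulr_sumr Mc mul0r addr0.
have Hp := ler_wpM2l (ltW iq) (sum_dvdn R M p0).
have Hq := ler_wpM2l (ltW ip) (sum_dvdn R M q0).
have := @sum_dvdn R (p * q) M; rewrite muln_gt0 p0 q0 => /(_ isT).
rewrite natrM invfM; lra.
Qed.

(** Either some prime differs from the three others, and [quad_moment_lone] applies, or the four
    primes pair off in one of three ways. When all four are equal the three pairings occur together;
    this overcount is harmless since [pair_sum] is nonnegative. *)
Lemma quad_moment (R : realFieldType) (T p q r s M : nat) :
  prime p -> prime q -> prime r -> prime s ->
  (p <= T)%N -> (q <= T)%N -> (r <= T)%N -> (s <= T)%N ->
  \sum_(1 <= m < M.+1) centered R p m * centered R q m * centered R r m * centered R s m <=
  2 * T%:R ^+ 4 + ((p == q)%:R * ((r == s)%:R * pair_sum R M p r)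
    + (p == r)%:R * ((q == s)%:R * pair_sum R M p q)
    + (p == s)%:R * ((q == r)%:R * pair_sum R M p q)).
Proof.
move=> pp pq pr ps pT qT rT sT.
pose c := pair_sum R M; rewrite -!/(c _ _).
have c0 a b : 0 <= c a b by exact: pair_sum_ge0.
have d0 (b : bool) : 0 <= b%:R :> R by [].
set W := (X in _ + X).
have W0 : 0 <= W by rewrite !addr_ge0 ?mulr_ge0.
have lone a b d e : prime a -> prime b -> prime d -> prime e ->
    (a <= T)%N -> (b <= T)%N -> (d <= T)%N -> (e <= T)%N ->
    (forall m, centered R a m * centered R b m * centered R d m * centered R e m =
       centered R p m * centered R q m * centered R r m * centered R s m) ->
    a != b -> a != d -> a != e ->
    \sum_(1 <= m < M.+1) centered R p m * centered R q m * centered R r m * centered R s m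
      <= 2 * T%:R ^+ 4 + W.
  move=> pa pb pd pe aT bT dT eT E ab ad ae.
  under eq_bigr do rewrite -E.
  by apply: le_trans (quad_moment_lone R M pa pb pd pe aT bT dT eT ab ad ae) _; lra.
have T0 : 0 <= 2 * T%:R ^+ 4 :> R by rewrite mulr_ge0 ?exprn_ge0.
suff [] : (\sum_(1 <= m < M.+1) centered R p m * centered R q m * centered R r m * centered R s m
   <= 2 * T%:R ^+ 4 + W) \/
   (\sum_(1 <= m < M.+1) centered R p m * centered R q m * centered R r m * centered R s m <= W); [by []|lra|].
have [epq|npq] := eqVneq p q.
  have [ers|nrs] := eqVneq r s.
    right; rewrite /W -epq -ers !eqxx !mul1r.
    suff -> : \sum_(1 <= m < M.+1) centered R p m * centered R p m * centered R r m * centered R r m = c p r.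
      by rewrite -addrA lerDl addr_ge0 ?mulr_ge0.
    by apply: eq_bigr => m _; ring.
  have [epr|npr] := eqVneq p r.
    left; apply: (lone s p q r) => //; first by move=> m; ring.
    - by rewrite epr eq_sym.
    - by rewrite -epq epr eq_sym.
    - by rewrite eq_sym.
  left; apply: (lone r p q s) => //; first by move=> m; ring.
  - by rewrite eq_sym.
  - by rewrite -epq eq_sym.
have [epr|npr] := eqVneq p r.
  have [eqs|nqs] := eqVneq q s.
    right; rewrite /W -epr -eqs !eqxx !mul1r.
    suff -> : \sum_(1 <= m < M.+1) centered R p m * centered R q m * centered R p m * centered R q m = c p q.
      by rewrite -addrA addrCA lerDl addr_ge0 ?mulr_ge0.
    by apply: eq_bigr => m _; ring.
  left; apply: (lone q p r s) => //; first by move=> m; ring.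
  - by rewrite eq_sym.
  - by rewrite -epr eq_sym.
have [eps|nps] := eqVneq p s; last first.
  by left; apply: (lone p q r s).
have [eqr|nqr] := eqVneq q r.
  right; rewrite /W -eps -eqr !eqxx !mul1r.
  suff -> : \sum_(1 <= m < M.+1) centered R p m * centered R q m * centered R q m * centered R p m = c p q.
    by rewrite lerDr addr_ge0 ?mulr_ge0.
  by apply: eq_bigr => m _; ring.
left; apply: (lone q p r s) => //; first by move=> m; ring.
- by rewrite eq_sym.
- by rewrite -eps eq_sym.
Qed.

Lemma size_bounded (T : nat) (S : seq nat) : uniq S -> all prime S ->
  {in S, forall p, p <= T}%N -> (size S <= T)%N.
Proof.
move=> uS pS ST; rewrite -(size_iota 1 T); apply: uniq_leq_size => // p pinS.
by rewrite mem_iota (prime_gt0 (allP pS p pinS)) add1n ltnS ST.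
Qed.

(** After expanding the fourth power, there are at most T^4 quadruples, each with error 2 T^4, and
    each of the three pairings contributes the double sum of [pair_sum]. *)
Lemma fourth_moment (R : realFieldType) (T M : nat) (S : seq nat) (L : R) :
  uniq S -> all prime S -> {in S, forall p, p <= T}%N ->
  L = \sum_(p <- S) p%:R^-1 ->
  \sum_(1 <= m < M.+1) (\sum_(p <- S) centered R p m) ^+ 4 <=
  2 * T%:R ^+ 8 + 3 * (4 * M%:R * L ^+ 2 + 2 * M%:R * L).
Proof.
move=> uS pS ST LE; pose c := pair_sum R M.
have Lc : \sum_(p <- S) \sum_(q <- S) c p q <= 4 * M%:R * L ^+ 2 + 2 * M%:R * L.
  apply: (@le_trans _ _ (\sum_(p <- S) \sum_(q <- S)
     (4 * M%:R * (p%:R^-1 * q%:R^-1) + (p == q)%:R * (2 * M%:R * q%:R^-1)))).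
    rewrite big_seq [leRHS]big_seq; apply: ler_sum => p pinS.
    rewrite big_seq [leRHS]big_seq; apply: ler_sum => q qinS.
    by apply: pair_moment; apply: (allP pS).
  under eq_bigr do rewrite big_split /=.
  rewrite big_split /= lerD //.
    under eq_bigr do rewrite -mulr_sumr -mulr_sumr.
    by rewrite -mulr_sumr -mulr_suml expr2 LE.
  rewrite big_seq (eq_bigr (fun p => 2 * M%:R * p%:R^-1)).
    by rewrite -big_seq -mulr_sumr LE.
  by move=> p pinS; rewrite (sum_delta (fun q => 2 * M%:R * q%:R^-1)).
under eq_bigr do rewrite sum_exp4.
rewrite exchange_big /=.
under eq_bigr do rewrite exchange_big /=.
under eq_bigr do under eq_bigr do rewrite exchange_big /=.
under eq_bigr do under eq_bigr do under eq_bigr do rewrite exchange_big /=.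
apply: (@le_trans _ _ (\sum_(p <- S) \sum_(q <- S) \sum_(r <- S) \sum_(s <- S)
  (2 * T%:R ^+ 4 + ((p == q)%:R * ((r == s)%:R * c p r)
    + (p == r)%:R * ((q == s)%:R * c p q) + (p == s)%:R * ((q == r)%:R * c p q))))).
  rewrite big_seq [leRHS]big_seq; apply: ler_sum => p pinS.
  rewrite big_seq [leRHS]big_seq; apply: ler_sum => q qinS.
  rewrite big_seq [leRHS]big_seq; apply: ler_sum => r rinS.
  rewrite big_seq [leRHS]big_seq; apply: ler_sum => s sinS.
  by apply: quad_moment; rewrite ?ST // (allP pS).
pose Q := \sum_(p <- S) \sum_(q <- S) c p q.
have Sc (x : R) : \sum_(p <- S) x = (size S)%:R * x.
  by rewrite big_const_seq count_predT iter_addr_0 mulr_natl.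
have -> : \sum_(p <- S) \sum_(q <- S) \sum_(r <- S) \sum_(s <- S)
  (2 * T%:R ^+ 4 + ((p == q)%:R * ((r == s)%:R * c p r)
    + (p == r)%:R * ((q == s)%:R * c p q) + (p == s)%:R * ((q == r)%:R * c p q)))
  = (size S)%:R ^+ 4 * (2 * T%:R ^+ 4) + (Q + Q + Q).
  transitivity (\sum_(p <- S) ((size S)%:R ^+ 3 * (2 * T%:R ^+ 4) +
      (\sum_(q <- S) c p q + \sum_(q <- S) c p q + \sum_(q <- S) c p q))).
    rewrite big_seq [RHS]big_seq; apply: eq_bigr => p pinS.
    transitivity (\sum_(q <- S) ((size S)%:R ^+ 2 * (2 * T%:R ^+ 4) +
      ((p == q)%:R * (\sum_(r <- S) c p r) + c p q + c p q))); last first.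
      rewrite !big_split /= Sc (sum_delta (fun=> \sum_(r <- S) c p r)) //.
      congr (_ + _); ring.
    rewrite big_seq [RHS]big_seq; apply: eq_bigr => q qinS.
    transitivity (\sum_(r <- S) ((size S)%:R * (2 * T%:R ^+ 4) +
      ((p == q)%:R * c p r + (p == r)%:R * c p q + (q == r)%:R * c p q))); last first.
      rewrite !big_split /= Sc -mulr_sumr (sum_delta (fun=> c p q)) //.
      rewrite (sum_delta (fun=> c p q)) //.
      by congr (_ + _); ring.
    rewrite big_seq [RHS]big_seq; apply: eq_bigr => r rinS.
    rewrite !big_split /= Sc -!mulr_sumr (sum_delta (fun=> c p r)) //.
    rewrite (sum_delta (fun=> c p q)) //.
    by rewrite (sum_delta (fun=> (q == r)%:R * c p q)).
  rewrite !big_split /= Sc /Q; ring.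
have sT : (size S)%:R ^+ 4 <= T%:R ^+ 4 :> R.
  by rewrite -!natrX ler_nat leq_exp2r // size_bounded.
have T4 : 0 <= T%:R ^+ 4 :> R by rewrite exprn_ge0.
have -> : T%:R ^+ 8 = T%:R ^+ 4 * T%:R ^+ 4 :> R by rewrite -exprD.
have := ler_wpM2r T4 sT; rewrite -/Q in Lc; lra.
Qed.

(** * Weights and Ramare's identity *)

Definition omega (S : seq nat) (n : nat) : nat := count (dvdn^~ n) S.

Lemma omegaE (R : pzSemiRingType) (S : seq nat) (n : nat) :
  (omega S n)%:R = \sum_(p <- S) (p %| n)%:R :> R.
Proof. by rewrite -natr_sum /omega -sum1_count big_mkcond. Qed.

Lemma omega_gt0 (S : seq nat) (p n : nat) : p \in S -> (p %| n)%N -> (0 < omega S n)%N.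
Proof. by move=> pS pn; rewrite -has_count; apply/hasP; exists p. Qed.

Lemma omega_mul (S : seq nat) (p m : nat) : uniq S -> all prime S -> p \in S ->
  ~~ (p %| m)%N -> omega S (p * m) = (omega S m).+1.
Proof.
move=> uS pS pinS pm; rewrite /omega -addn1.
rewrite (eq_in_count (a2 := predU (dvdn^~ m) (pred1 p))); last first.
  move=> q qS /=; rewrite Euclid_dvdM ?(allP pS q) // dvdn_prime2 ?(allP pS) //.
  by rewrite orbC.
have := count_predUI (dvdn^~ m) (pred1 p) S.
rewrite (_ : count (predI _ _) S = 0%N) ?addn0; last first.
  apply/eqP; rewrite -leqn0 leqNgt -has_count; apply/hasPn => q _ /=.
  by apply/negP => /andP[qm /eqP qp]; rewrite -qp qm in pm.
by move=> ->; rewrite count_uniq_mem // pinS.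
Qed.

(** For L <= 1 the trivial bound gives W = 20; otherwise W = 20 / L. The condition on [M] absorbs
    the error 2 T^8 of the fourth moment. *)
Lemma weight_sum (R : realFieldType) (T : nat) (S : seq nat) (L : R) :
  uniq S -> all prime S -> {in S, forall p, p <= T}%N ->
  L = \sum_(p <- S) p%:R^-1 ->
  exists W : R, [/\ 0 < W, W <= 20, W * L <= 20 &
    forall M : nat, (2 * T ^ 8 <= M)%N ->
      \sum_(1 <= m < M.+1) ((omega S m).+1%:R^-1) ^+ 2 <= M%:R * W ^+ 2].
Proof.
move=> uS pS ST LE.
have M0 (M : nat) : 0 <= M%:R :> R by [].
have Mc (M : nat) (c : R) : \sum_(1 <= m < M.+1) c = M%:R * c.
  by rewrite sumr_const_nat subn1 mulr_natl.
have v1 m : 0 < ((omega S m).+1%:R^-1 : R) <= 1.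
  by rewrite invr_gt0 ltr0n invf_le1 ?ltr0n // ler1n.
have [L1|L1] := leP L 1.
  exists 20; split; [by []|by []|lra|move=> M _].
  apply: (@le_trans _ _ (\sum_(1 <= m < M.+1) (1 : R))).
    by apply: ler_sum => m _; have /andP[/ltW v0 v1'] := v1 m; rewrite exprn_ile1.
  rewrite Mc ler_wpM2l //; nra.
have L0 : 0 < L by lra.
pose l := L^-1; have lL : l * L = 1 by rewrite mulVf // gt_eqF.
have l0 : 0 < l by rewrite invr_gt0.
have l1 : l <= 1 by rewrite invf_le1 // ltW.
exists (20 * l); split; [by rewrite mulr_gt0|lra|by rewrite -mulrA lL; lra|move=> M TM].
have fm := fourth_moment M uS pS ST LE.
(* A pointwise form of Markov's inequality: if omega m >= L/2 the first term suffices; otherwise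
   omega m is at distance more than L/2 from L and the second term is at least 1. *)
have tb m : ((omega S m).+1%:R^-1) ^+ 2 <=
    4 * l ^+ 2 + 16 * l ^+ 4 * (\sum_(p <- S) centered R p m) ^+ 4.
  have -> : \sum_(p <- S) centered R p m = (omega S m)%:R - L.
    by rewrite /centered sumrB -omegaE -LE.
  have := v1 m; have : (omega S m).+1%:R * (omega S m).+1%:R^-1 = 1 :> R.
    by rewrite divff // pnatr_eq0.
  rewrite -natr1; have := M0 (omega S m).
  move: (omega S m)%:R => w; move: (_^-1) => v w0 vw /andP[v0 v1'].
  have [wL|wL] := leP (L / 2) w.
    have : v <= 2 * l.
      have : v * L <= 2 by nra.
      by move=> vL; rewrite /l ler_pdivlMr.
    have : 0 <= 16 * l ^+ 4 * (w - L) ^+ 4.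
      by rewrite mulr_ge0 ?exprn_even_ge0 // mulr_ge0 // ?exprn_even_ge0.
    nra.
  pose u := l * (L - w); have u2 : 1 / 2 <= u.
    by have := ler_wpM2l (ltW l0) (ltW wL); rewrite /u; lra.
  have -> : 16 * l ^+ 4 * (w - L) ^+ 4 = 16 * u ^+ 4 by rewrite /u; ring.
  have u4 : 1 / 4 <= u ^+ 2 by nra.
  have : 1 / 16 <= u ^+ 4 by rewrite (exprM u 2 2); nra.
  nra.
apply: (@le_trans _ _ (\sum_(1 <= m < M.+1)
   (4 * l ^+ 2 + 16 * l ^+ 4 * (\sum_(p <- S) centered R p m) ^+ 4))).
  exact: ler_sum.
rewrite big_split /= Mc -mulr_sumr.
have l4 : 0 <= 16 * l ^+ 4 by rewrite mulr_ge0 ?exprn_ge0 ?(ltW l0).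
have := ler_wpM2l l4 fm.
have TM' : 2 * T%:R ^+ 8 <= M%:R :> R by rewrite -natrX -natrM ler_nat.
have -> : 16 * l ^+ 4 * (2 * T%:R ^+ 8 + 3 * (4 * M%:R * L ^+ 2 + 2 * M%:R * L)) =
   16 * l ^+ 4 * (2 * T%:R ^+ 8) + M%:R * (192 * l ^+ 2 * (l * L) ^+ 2 + 96 * l ^+ 3 * (l * L)) by ring.
rewrite lL => H1.
have H2 := ler_wpM2l l4 TM'.
have l2 : 0 <= l ^+ 2 by rewrite exprn_ge0 // ltW.
have l3 : l ^+ 3 <= l ^+ 2 by rewrite exprS ler_piMl.
have l4' : l ^+ 4 <= l ^+ 2 by rewrite exprS; nra.
(* The coefficients 4, 16, 192 and 96 of M l^2 add up to 308, below 20^2. *)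
have H3 := ler_wpM2l (M0 M) l3.
have H4 := ler_wpM2l (M0 M) l4'.
have H5 := mulr_ge0 (M0 M) l2.
lra.
Qed.

Lemma sum_multiples (V : nmodType) (p N : nat) (G : nat -> V) : (0 < p)%N ->
  \sum_(1 <= n < N.+1 | (p %| n)%N) G n = \sum_(1 <= m < (N %/ p).+1) G (p * m)%N.
Proof.
move=> p0; elim: N => [|N IH]; first by rewrite div0n !big_geq.
rewrite big_mkcond big_nat_recr //= -big_mkcond /= IH divnS //.
case: ifP => pN /=; last by rewrite addr0 add0n.
rewrite add1n [RHS]big_nat_recr //=; congr (_ + G _).
by rewrite -(divnK pN) divnS // pN add1n mulnC.
Qed.

(** When the sums are exchanged, n receives [g n / omega S n] once for each of its [omega S n]
    divisors in [S]. *)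
Lemma ramare_identity (K : numFieldType) (S : seq nat) (N : nat) (g : nat -> K) :
  all prime S ->
  \sum_(1 <= n < N.+1) g n =
  \sum_(1 <= n < N.+1 | omega S n == 0%N) g n +
  \sum_(p <- S) \sum_(1 <= m < (N %/ p).+1) g (p * m)%N / (omega S (p * m))%:R.
Proof.
move=> pS.
rewrite (bigID (fun n => omega S n == 0%N)) /=; congr (_ + _).
transitivity (\sum_(p <- S) \sum_(1 <= n < N.+1 | (p %| n)%N) g n / (omega S n)%:R).
  under [RHS]eq_bigr do rewrite big_mkcond.
  rewrite exchange_big big_mkcond /=; apply: eq_bigr => n _.
  transitivity (\sum_(p <- S) (p %| n)%:R * (g n / (omega S n)%:R)).
    rewrite -mulr_suml -omegaE; case: eqP => [->|/eqP w0] /=; first by rewrite mul0r.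
    by rewrite mulrCA divff ?mulr1 // pnatr_eq0.
  by apply: eq_bigr => p _; case: ifP; rewrite ?mul1r ?mul0r.
rewrite big_seq [RHS]big_seq; apply: eq_bigr => p pinS.
by rewrite (sum_multiples _ (fun n => g n / (omega S n)%:R)) // prime_gt0 // (allP pS).
Qed.

(** Summing the squares of [t * a i - b i] gives a quadratic inequality in t, and t = B / A is the
    optimal choice; no square root is taken. *)
Lemma cauchy_schwarz (R : realFieldType) (I : Type) (r : seq I) (a b : I -> R) (A B : R) :
  0 < A -> 0 <= B -> \sum_(i <- r) a i ^+ 2 <= A ^+ 2 -> \sum_(i <- r) b i ^+ 2 <= B ^+ 2 ->
  \sum_(i <- r) a i * b i <= A * B.
Proof.
move=> A0 B0 ha hb.
have amgm (t : R) : 0 < t -> 2 * t * (\sum_(i <- r) a i * b i) <= A ^+ 2 * t ^+ 2 + B ^+ 2.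
  move=> t0; apply: (@le_trans _ _ (\sum_(i <- r) (t ^+ 2 * a i ^+ 2 + b i ^+ 2))).
    rewrite mulr_sumr; apply: ler_sum => i _.
    by have := sqr_ge0 (t * a i - b i); lra.
  rewrite big_split /= -mulr_sumr; have := sqr_ge0 t; nra.
have [B00|B0'] := eqVneq B 0; last first.
  have Bp : 0 < B by rewrite lt_def B0' B0.
  have tp : 0 < B / A by rewrite divr_gt0.
  have := amgm _ tp; set s := \sum_(i <- r) _.
  have -> : A ^+ 2 * (B / A) ^+ 2 + B ^+ 2 = 2 * (B / A) * (A * B).
    by field; rewrite gt_eqF.
  by rewrite ler_pM2l // mulr_gt0.
(* For B = 0 the optimal t is no longer positive. If the sum s were positive, t = s / A^2 would give
   2 s^2 / A^2 <= s^2 / A^2. *)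
rewrite B00 mulr0; rewrite leNgt; apply/negP => s0.
move: (amgm (\sum_(i <- r) a i * b i / A ^+ 2)).
rewrite -mulr_suml; set s := \sum_(i <- r) _ in s0 *.
have A2 : 0 < A ^+ 2 by rewrite exprn_gt0.
rewrite divr_gt0 // => /(_ isT); rewrite B00.
have -> : A ^+ 2 * (s / A ^+ 2) ^+ 2 + 0 ^+ 2 = s ^+ 2 / A ^+ 2.
  by field; rewrite gt_eqF.
have -> : 2 * (s / A ^+ 2) * s = 2 * (s ^+ 2 / A ^+ 2) by field; rewrite gt_eqF.
have : 0 < s ^+ 2 / A ^+ 2 by rewrite divr_gt0 // exprn_gt0.
lra.
Qed.

(** * Dyadic sums over primes *)

Lemma ler_sum_subset (R : numDomainType) (S : seq nat) (a b : nat) (h : nat -> R) :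
  uniq S -> {in S, forall p, a <= p < b}%N -> (forall n, 0 <= h n) ->
  \sum_(p <- S) h p <= \sum_(a <= n < b) h n.
Proof.
move=> uS Sab h0.
rewrite (perm_big [seq n <- index_iota a b | n \in S]) /=; last first.
  apply: uniq_perm; rewrite ?filter_uniq ?iota_uniq // => n.
  by rewrite mem_filter mem_index_iota; case: (boolP (n \in S)) => // /Sab ->.
by rewrite big_filter big_mkcond; apply: ler_sum => n _; case: ifP.
Qed.

(** Telescoping from 1/n^2 <= 1/(n-1) - 1/n, then 1/(y-1) <= 2/y. *)
Lemma sum_inv_sqr (R : realFieldType) (S : seq nat) (y T : nat) :
  uniq S -> (2 <= y)%N -> {in S, forall p, y <= p <= T}%N ->
  \sum_(p <- S) (p%:R^-1) ^+ 2 <= 2 / y%:R :> R.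
Proof.
move=> uS y2 Sy.
have [Ty|yT] := ltnP T y.
  rewrite big1_seq ?divr_ge0 // => p /andP[_ /Sy /andP[yp pT]].
  by have := leq_trans yp pT; rewrite leqNgt Ty.
apply: (@le_trans _ _ (\sum_(y <= n < T.+1) (n%:R^-1) ^+ 2)).
  by apply: ler_sum_subset => // n; rewrite exprn_ge0 // invr_ge0.
have H (t : nat) : (y <= t)%N ->
    \sum_(y <= n < t) (n%:R^-1) ^+ 2 <= (y%:R - 1)^-1 - (t%:R - 1)^-1 :> R.
  elim: t => [|t IH]; first by rewrite leqn0 => /eqP y0; rewrite y0 in y2.
  rewrite leq_eqVlt => /predU1P[->|yt]; first by rewrite big_geq // subrr.
  rewrite big_nat_recr //= -natr1 addrK; have := IH yt.
  have t2 : 2 <= t%:R :> R by rewrite ler_nat (leq_trans y2).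
  have : (t%:R^-1) ^+ 2 <= (t%:R - 1)^-1 - t%:R^-1 :> R.
    have -> : (t%:R - 1)^-1 - t%:R^-1 = (t%:R * (t%:R - 1))^-1 :> R.
      by field; rewrite !gt_eqF //; lra.
    rewrite exprVn lef_pV2 ?posrE ?exprn_gt0 ?mulr_gt0 //; nra.
  lra.
have := H T.+1 (leqW yT).
have y2' : 2 <= y%:R :> R by rewrite ler_nat.
have : 0 <= (T.+1%:R - 1)^-1 :> R by rewrite invr_ge0 -natr1 addrK.
have : (y%:R - 1)^-1 <= 2 / y%:R :> R.
  rewrite -[leLHS]mul1r ler_pdivrMr; last lra.
  by rewrite mulrAC ler_pdivlMr; lra.
lra.
Qed.

Definition dyadic (S : seq nat) (k : nat) : seq nat :=
  [seq p <- S | trunc_log 2 p == k].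

Lemma mem_dyadic (S : seq nat) (k p : nat) : {in S, forall p, 0 < p}%N ->
  p \in dyadic S k -> p \in S /\ (2 ^ k <= p < 2 ^ k.+1)%N.
Proof.
move=> S0; rewrite mem_filter => /andP[/eqP <- pS]; split=> //.
by rewrite trunc_logP ?S0 // trunc_log_ltn.
Qed.

Lemma sum_dyadic (V : nmodType) (S : seq nat) (T : nat) (G : nat -> V) :
  {in S, forall p, 0 < p <= T}%N ->
  \sum_(0 <= k < T.+1) \sum_(p <- dyadic S k) G p = \sum_(p <- S) G p.
Proof.
move=> ST.
transitivity (\sum_(0 <= k < T.+1) \sum_(p <- S) if trunc_log 2 p == k then G p else 0).
  by apply: eq_bigr => k _; rewrite big_filter big_mkcond.
rewrite exchange_big /= big_seq [RHS]big_seq; apply: eq_bigr => p /ST /andP[p0 pT].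
(* The crude k < 2^k <= p <= T shows that the blocks up to [T] exhaust [S]. *)
have kT : (trunc_log 2 p < T.+1)%N.
  by rewrite ltnS (leq_trans _ pT) // (leq_trans (ltnW (ltn_expl _ (ltnSn 1)))) // trunc_logP.
rewrite -big_mkcond /= big_mkord.
by rewrite (big_pred1 (Ordinal kT)) // => i; rewrite eq_sym -val_eqE.
Qed.

Lemma size_dyadic (S : seq nat) (k : nat) : uniq S -> {in S, forall p, 0 < p}%N ->
  (size (dyadic S k) <= 2 ^ k)%N.
Proof.
move=> uS S0; rewrite -[leqRHS](size_iota (2 ^ k)).
apply: uniq_leq_size; first exact: filter_uniq.
move=> p /(mem_dyadic S0)[_]; rewrite mem_iota.
by rewrite addnn -mul2n expnS.
Qed.

(** A block has at most 2^k elements, so the square roots are dominated by a geometric series of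
    ratio 1/sqrt 2 starting near log2 y, which the bound 2/y <= A^2 controls. In the linear term,
    1/2^k <= 2/p for every p of the block, which recovers 2 L. *)
Lemma dyadic_total (R : rcfType) (S : seq nat) (T y : nat) (L A B b : R) :
  uniq S -> (0 < y)%N -> {in S, forall p, y <= p <= T}%N ->
  L = \sum_(p <- S) p%:R^-1 -> 0 <= A -> 0 <= B -> 0 <= b -> 2 / y%:R <= A ^+ 2 ->
  \sum_(0 <= k < T.+1) (2 ^ k)%:R^-1 *
     (Num.sqrt (size (dyadic S k))%:R * B + (size (dyadic S k))%:R * b)
  <= 4 * A * B + 2 * L * b.
Proof.
move=> uS y0 Sy LE A0 B0 b0 yA.
have S0 : {in S, forall p, 0 < p}%N by move=> p /Sy/andP[yp _]; exact: leq_trans yp.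
have i2 k : 0 < (2 ^ k)%:R^-1 :> R by rewrite invr_gt0 ltr0n expn_gt0.
under eq_bigr do rewrite mulrDr !mulrA.
rewrite big_split /= -!mulr_suml lerD //; apply: ler_wpM2r => //.
  pose th : R := Num.sqrt 2^-1.
  have th2 : th ^+ 2 = 2^-1 by rewrite sqr_sqrtr // invr_ge0.
  have th0 : 0 < th by rewrite sqrtr_gt0 invr_gt0.
  have th34 : th <= 3 / 4.
    by rewrite leNgt; apply/negP => h; nra.
  have thk k : (th ^+ k) ^+ 2 = (2 ^ k)%:R^-1 by rewrite -exprM mulnC exprM th2 exprVn natrX.
  pose k0 := trunc_log 2 y.
  have thA : th ^+ k0 <= A.
    rewrite -ler_sqr ?nnegrE ?exprn_ge0 ?(ltW th0) // thk; apply: le_trans yA.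
    rewrite -[leLHS]mul1r ler_pdivrMr ?ltr0n ?expn_gt0 // mulrAC ler_pdivlMr ?ltr0n //.
    by rewrite mul1r -natrM -expnS ler_nat ltnW // trunc_log_ltn.
  have geo (K : nat) : \sum_(0 <= k < K | (k0 <= k)%N) th ^+ k <= 4 * th ^+ k0.
    (* A telescoping strengthening: th <= 3/4 gives th^K <= 4 (th^K - th^(K+1)). The maximum with
       [k0] makes the bound vanish until the range passes [k0]. *)
    suff : \sum_(0 <= k < K | (k0 <= k)%N) th ^+ k <= 4 * (th ^+ k0 - th ^+ (maxn K k0)).
      by have := exprn_ge0 (maxn K k0) (ltW th0); lra.
    elim: K => [|K IH]; first by rewrite big_geq // max0n subrr mulr0.
    rewrite big_mkcond big_nat_recr //= -big_mkcond /=; case: (leqP k0 K) => kK.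
      rewrite (maxn_idPl (leqW kK)); rewrite (maxn_idPl kK) in IH.
      by have := exprn_ge0 K (ltW th0); rewrite exprS; nra.
    rewrite (maxn_idPr kK) subrr; rewrite (maxn_idPr (ltnW kK)) subrr in IH.
    by rewrite addr0.
  apply: (@le_trans _ _ (\sum_(0 <= k < T.+1 | (k0 <= k)%N) th ^+ k)); last first.
    by apply: le_trans (geo _) _; rewrite ler_pM2l.
  rewrite [leRHS]big_mkcond; apply: ler_sum => k _.
  have sk := size_dyadic k uS S0.
  have [k0k|kk0] := leqP k0 k.
    have : Num.sqrt (size (dyadic S k))%:R <= (th ^+ k)^-1.
      rewrite -ler_sqr ?nnegrE ?sqrtr_ge0 ?invr_ge0 ?exprn_ge0 ?(ltW th0) //.
      by rewrite sqr_sqrtr // exprVn thk invrK ler_nat.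
    move=> /(ler_wpM2l (ltW (i2 k)))/le_trans; apply; rewrite -thk expr2.
    by rewrite mulfK // expf_neq0 // gt_eqF.
  (* Below [k0] the block lies under 2^k0 <= y, where [S] has no element. *)
  suff -> : dyadic S k = [::] by rewrite sqrtr0 mulr0.
  case E : (dyadic S k) => [//|p s].
  have /(mem_dyadic S0)[/Sy/andP[yp _] /andP[_ pk]] : p \in dyadic S k by rewrite E mem_head.
  have : (2 ^ k.+1 <= 2 ^ k0)%N by rewrite leq_exp2l.
  move=> /leq_trans /(_ (trunc_logP (ltnSn 1) y0)) /leq_trans /(_ yp).
  by rewrite leqNgt pk.
rewrite LE -(sum_dyadic (S := S) (T := T) (fun p => p%:R^-1)); last first.
  by move=> p pS; rewrite S0 //; have /andP[] := Sy p pS.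
rewrite mulr_sumr; apply: ler_sum => k _.
rewrite -sum1_size natr_sum mulr_sumr mulr_sumr big_seq [leRHS]big_seq.
apply: ler_sum => p /(mem_dyadic S0)[pS /andP[_ pk]]; rewrite mulr1.
have p0 : 0 < p%:R :> R by rewrite ltr0n S0.
rewrite ler_pdivlMr // mulrC ler_pdivrMr ?ltr0n ?expn_gt0 //.
by rewrite -natrM -expnS ler_nat ltnW.
Qed.

(** * The bilinear estimate on a dyadic range *)

(** The norm on [R[i]] takes values in [R[i]] itself; this embedding transfers its laws to the
    real-valued [cmod]. *)
Lemma cmodE (R : realType) (z : R[i]) : (cmod z)%:C%C = `|z|.
Proof. by case: z => a b; rewrite normc_def. Qed.

Lemma cmod_ge0 (R : realType) (z : R[i]) : 0 <= cmod z.
Proof. by rewrite -lecR cmodE normr_ge0. Qed.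

Lemma cmod0 (R : realType) : cmod (0 : R[i]) = 0.
Proof. by apply: complexI; rewrite cmodE normr0. Qed.

Lemma cmodM (R : realType) (x y : R[i]) : cmod (x * y) = cmod x * cmod y.
Proof. by apply: complexI; rewrite rmorphM /= !cmodE normrM. Qed.

Lemma cmodV (R : realType) (x : R[i]) : cmod x^-1 = (cmod x)^-1.
Proof. exact: Normc.normcV. Qed.

Lemma cmod_nat (R : realType) (n : nat) : cmod (n%:R : R[i]) = n%:R.
Proof. by apply: complexI; rewrite cmodE normr_nat rmorph_nat. Qed.

Lemma cmodD (R : realType) (x y : R[i]) : cmod (x + y) <= cmod x + cmod y.
Proof. by rewrite -lecR rmorphD /= !cmodE ler_normD. Qed.

Lemma cmod_conj (R : realType) (x : R[i]) : cmod x^* = cmod x.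
Proof. by apply: complexI; rewrite !cmodE norm_conjC. Qed.

Lemma cmod_sqr (R : realType) (x : R[i]) : (cmod x ^+ 2)%:C%C = x * x^*.
Proof. by rewrite rmorphXn /= cmodE normCK. Qed.

Lemma cmod_sum (R : realType) (I : Type) (r : seq I) (P : pred I) (h : I -> R[i]) :
  cmod (\sum_(i <- r | P i) h i) <= \sum_(i <- r | P i) cmod (h i).
Proof.
rewrite -lecR rmorph_sum /= cmodE; apply: le_trans (ler_norm_sum _ _ _) _.
by apply: ler_sum => i _; rewrite cmodE.
Qed.

(** The range of m depends on p; moving that dependence into the condition gives all p of a block a
    common range, so that the sums over p and m can be exchanged. *)
Lemma sum_dilated (V : nmodType) (p P N : nat) (c : pred nat) (G : nat -> V) :
  (0 < P)%N -> (P <= p)%N ->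
  \sum_(1 <= m < (N %/ p).+1 | c m) G m =
  \sum_(1 <= m < (N %/ P).+1 | c m && (p * m <= N)%N) G m.
Proof.
move=> P0 Pp; have p0 := leq_trans P0 Pp.
rewrite (big_nat_widen _ _ (N %/ P).+1); last by rewrite ltnS leq_div2l.
by apply: eq_bigl => m; rewrite ltnS leq_divRL // mulnC.
Qed.

(** Once m is the outer variable, [f m] factors out and is bounded by 1. Cauchy-Schwarz then
    separates [w] from the sum over p. In the expanded square the diagonal pairs are bounded
    trivially through [B], and the others through the bilinear hypothesis. *)
Lemma block_bound (R : realType) (U : seq nat) (P N : nat) (X W B b : R)
    (f F : nat -> R[i]) (w : nat -> R) :
  uniq U -> all prime U -> (0 < P)%N -> {in U, forall p, P <= p}%N ->
  0 < X -> N%:R <= X -> 0 < W -> 0 <= B -> 0 <= b ->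
  (forall n, (0 < n)%N -> cmod (f n) <= 1) ->
  (forall n, (0 < n)%N -> cmod (F n) <= B) ->
  (forall m, 0 <= w m) ->
  \sum_(1 <= m < (N %/ P).+1) w m ^+ 2 <= X / P%:R * W ^+ 2 ->
  {in U &, forall p p', (p < p')%N ->
    cmod (\sum_(1 <= m < (N %/ p').+1 | coprime m (p * p')%N)
      F (p * m)%N * (F (p' * m)%N)^*) <= X / p'%:R * b ^+ 2} ->
  cmod (\sum_(p <- U) \sum_(1 <= m < (N %/ p).+1 | ~~ (p %| m)%N)
     f p * f m * F (p * m)%N * (w m)%:C%C) <=
  X / P%:R * W * (Num.sqrt (size U)%:R * B + (size U)%:R * b).
Proof.
move=> uU pU P0 PU X0 NX W0 B0 b0 f1 FB w0 hw off.
have XP : 0 < X / P%:R by rewrite divr_gt0 // ltr0n.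
pose M := (N %/ P)%N.
have MX : M%:R <= X / P%:R.
  by rewrite ler_pdivlMr ?ltr0n // (le_trans _ NX) // -natrM ler_nat leq_divM.
(* Extension by zero encodes both the range of m and the condition that p does not divide m. *)
pose s p m : R[i] := if ~~ (p %| m)%N && (p * m <= N)%N then f p * F (p * m)%N else 0.
pose G m := \sum_(p <- U) s p m.
have -> : \sum_(p <- U) \sum_(1 <= m < (N %/ p).+1 | ~~ (p %| m)%N)
     f p * f m * F (p * m)%N * (w m)%:C%C = \sum_(1 <= m < M.+1) f m * (w m)%:C%C * G m.
  under [RHS]eq_bigr do rewrite mulr_sumr.
  rewrite [RHS]exchange_big big_seq [RHS]big_seq /=; apply: eq_bigr => p pinU.
  rewrite (sum_dilated _ _ _ P0 (PU p pinU)) big_mkcond; apply: eq_bigr => m _.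
  by rewrite /s; case: ifP => _; rewrite ?mulr0 //; ring.
apply: le_trans (cmod_sum _ _ _) _.
apply: (@le_trans _ _ (\sum_(1 <= m < M.+1) w m * cmod (G m))).
  rewrite big_nat [leRHS]big_nat; apply: ler_sum => m /andP[m0 _].
  rewrite !cmodM ler_wpM2r ?cmod_ge0 //.
  have -> : cmod (w m)%:C%C = w m.
    by apply: complexI; rewrite cmodE ger0_norm // lecR.
  by rewrite ler_piMl ?f1.
set sz := (size U)%:R; have sz0 : 0 <= sz :> R by [].
pose q := Num.sqrt (X / P%:R); have q0 : 0 < q by rewrite sqrtr_gt0.
have q2 : q ^+ 2 = X / P%:R by rewrite sqr_sqrtr // ltW.
pose v := Num.sqrt sz; have v0 : 0 <= v by rewrite sqrtr_ge0.
have v2 : v ^+ 2 = sz by rewrite sqr_sqrtr.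
rewrite (_ : X / P%:R * W * _ = (q * W) * (q * (v * B + sz * b))); last first.
  by rewrite -q2 /v; ring.
apply: cauchy_schwarz.
- by rewrite mulr_gt0.
- by rewrite !(mulr_ge0, addr_ge0) // ltW.
- by rewrite exprMn q2.
have -> : \sum_(1 <= m < M.+1) cmod (G m) ^+ 2 =
    cmod (\sum_(p <- U) \sum_(p' <- U) \sum_(1 <= m < M.+1) s p m * (s p' m)^*).
  apply: complexI; rewrite cmodE.
  have -> : \sum_(p <- U) \sum_(p' <- U) \sum_(1 <= m < M.+1) s p m * (s p' m)^* =
     \sum_(1 <= m < M.+1) (cmod (G m) ^+ 2)%:C%C.
    under eq_bigr do rewrite exchange_big /=.
    rewrite exchange_big /=; apply: eq_bigr => m _.
    rewrite cmod_sqr /G mulr_suml; apply: eq_bigr => p _.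
    by rewrite rmorph_sum mulr_sumr.
  rewrite rmorph_sum ger0_norm // sumr_ge0 // => m _.
  by rewrite lecR exprn_ge0 // cmod_ge0.
have sB p m : (0 < p)%N -> (0 < m)%N -> cmod (s p m) <= B.
  move=> p0 m0; rewrite /s; case: ifP => _; last by rewrite cmod0.
  rewrite cmodM -[B]mul1r ler_pM ?cmod_ge0 ?f1 ?FB //.
  by rewrite muln_gt0 p0.
have offs p p' : p \in U -> p' \in U -> (p < p')%N ->
    cmod (\sum_(1 <= m < M.+1) s p m * (s p' m)^*) <= X / P%:R * b ^+ 2.
  move=> pinU p'inU pp'.
  have [pp pp''] := (allP pU p pinU, allP pU p' p'inU).
  (* The two non-divisibility conditions merge into coprimality with [p * p'], and of the two ranges
     the one for the larger prime [p'] is the binding one. *)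
  have -> : \sum_(1 <= m < M.+1) s p m * (s p' m)^* = (f p * (f p')^*) *
     \sum_(1 <= m < (N %/ p').+1 | coprime m (p * p')%N) F (p * m)%N * (F (p' * m)%N)^*.
    rewrite (sum_dilated _ _ _ P0 (PU p' p'inU)) [in RHS]big_mkcond mulr_sumr.
    apply: eq_bigr => m _; rewrite /s coprimeMr !(coprime_sym m) !prime_coprime //.
    case: (boolP (p %| m)%N) => pm; case: (boolP (p' %| m)%N) => p'm;
      rewrite /= ?(rmorph0, mulr0, mul0r) //.
    case: (leqP (p' * m) N) => p'mN; rewrite /= ?(rmorph0, mulr0, mul0r) //.
    rewrite (leq_trans _ p'mN) ?leq_mul2r ?(ltnW pp') ?orbT //.
    by rewrite rmorphM; ring.
  rewrite !cmodM cmod_conj.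
  apply: (@le_trans _ _ (1 * (X / p'%:R * b ^+ 2))).
    rewrite ler_pM ?mulr_ge0 ?cmod_ge0 ?off //.
    by rewrite mulr_ile1 ?cmod_ge0 ?f1 ?prime_gt0.
  rewrite mul1r ler_wpM2r ?sqr_ge0 // ler_pM2l //.
  by rewrite lef_pV2 ?posrE ?ltr0n ?(prime_gt0 pp'') // ler_nat PU.
apply: le_trans (cmod_sum _ _ _) _.
apply: (@le_trans _ _ (\sum_(p <- U) \sum_(p' <- U)
   ((p == p')%:R * (X / P%:R * B ^+ 2) + X / P%:R * b ^+ 2))).
  rewrite big_seq [leRHS]big_seq; apply: ler_sum => p pinU.
  apply: le_trans (cmod_sum _ _ _) _.
  rewrite big_seq [leRHS]big_seq; apply: ler_sum => p' p'inU.
  have p0 := prime_gt0 (allP pU p pinU).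
  have b2 : 0 <= X / P%:R * b ^+ 2 by rewrite mulr_ge0 ?sqr_ge0 ?(ltW XP).
  have [pp'|pp'|<-] := ltngtP p p'.
  - by rewrite mul0r add0r offs.
  (* Conjugation exchanges p and p', reducing to the ordered case. *)
  - rewrite mul0r add0r -cmod_conj rmorph_sum.
    under eq_bigr do rewrite rmorphM /= conjCK mulrC.
    exact: offs.
  rewrite mul1r -[leLHS]addr0 lerD //; apply: le_trans (cmod_sum _ _ _) _.
  apply: (@le_trans _ _ (\sum_(1 <= m < M.+1) B ^+ 2)).
    rewrite big_nat [leRHS]big_nat; apply: ler_sum => m /andP[m0 _].
    by rewrite cmodM cmod_conj expr2 ler_pM ?cmod_ge0 ?sB.
  rewrite sumr_const_nat subn1 -[leLHS]mulr_natl.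
  by rewrite ler_wpM2r // sqr_ge0.
have Uc (x : R) : \sum_(p <- U) x = sz * x.
  by rewrite big_const_seq count_predT iter_addr_0 mulr_natl.
rewrite (_ : \sum_(p <- U) _ = sz * (X / P%:R * B ^+ 2) + sz * (sz * (X / P%:R * b ^+ 2))).
  (* The two contributions are the squares of the two summands; the nonnegative cross term is
     dropped. *)
  have -> : (q * (v * B + sz * b)) ^+ 2 = v ^+ 2 * (q ^+ 2 * B ^+ 2) +
      sz * (sz * (q ^+ 2 * b ^+ 2)) + 2 * (q ^+ 2 * (v * B * (sz * b))) by ring.
  rewrite q2 v2.
  have : 0 <= X / P%:R * (v * B * (sz * b)) by rewrite !mulr_ge0 // ltW.
  lra.
transitivity (\sum_(p <- U) (X / P%:R * B ^+ 2 + sz * (X / P%:R * b ^+ 2))).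
  rewrite big_seq [RHS]big_seq; apply: eq_bigr => p pinU.
  by rewrite big_split /= Uc (sum_delta (fun=> X / P%:R * B ^+ 2)).
by rewrite Uc mulrDr.
Qed.

(** * The main estimate *)

(** [ramare_identity] isolates the sieve term. The pairs with p | m form [rest], of size the sum of
    1/p^2; in [main] multiplicativity splits [f (p * m)], and [block_bound] is applied to each
    dyadic block. *)
Lemma sum_multiplicative_le (R : realType) (S : seq nat) (T y N : nat) (X A B b : R)
    (f F : nat -> R[i]) :
  uniq S -> all prime S -> {in S, forall p, y <= p <= T}%N -> (2 <= y)%N ->
  (T ^ 10 <= N)%N -> 0 < X -> N%:R <= X ->
  0 <= A -> 2 / y%:R <= A -> 2 / y%:R <= A ^+ 2 -> 0 <= B -> 0 <= b ->
  multiplicative_fun f ->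
  (forall n, (0 < n)%N -> cmod (f n) <= 1) ->
  (forall n, (0 < n)%N -> cmod (F n) <= B) ->
  {in S &, forall p p', (p < p')%N ->
    cmod (\sum_(1 <= m < (N %/ p').+1 | coprime m (p * p')%N)
      F (p * m)%N * (F (p' * m)%N)^*) <= X / p'%:R * b ^+ 2} ->
  cmod (\sum_(1 <= n < N.+1) f n * F n) <=
  \sum_(1 <= n < N.+1 | omega S n == 0%N) cmod (F n) + X * (81 * A * B + 40 * b).
Proof.
move=> uS pS Sy y2 TN X0 NX A0 yA yA2 B0 b0 fmul f1 FB off.
have S0 : {in S, forall p, 0 < p}%N by move=> p /(allP pS)/prime_gt0.
have ST : {in S, forall p, p <= T}%N by move=> p /Sy/andP[].
pose L : R := \sum_(p <- S) p%:R^-1.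
have [W [W0 W20 WL hW]] := weight_sum uS pS ST (erefl L).
pose w m : R := (omega S m).+1%:R^-1.
have w0 m : 0 <= w m by rewrite invr_ge0.
have wC m : (w m)%:C%C = (omega S m).+1%:R^-1 by rewrite /w fmorphV rmorph_nat.
pose main p := \sum_(1 <= m < (N %/ p).+1 | ~~ (p %| m)%N)
   f p * f m * F (p * m)%N * (w m)%:C%C.
pose rest p := \sum_(1 <= m < (N %/ p).+1 | (p %| m)%N)
   f (p * m)%N * F (p * m)%N / (omega S (p * m))%:R.
rewrite (ramare_identity _ _ pS).
have -> : \sum_(p <- S) \sum_(1 <= m < (N %/ p).+1)
    f (p * m)%N * F (p * m)%N / (omega S (p * m))%:R =
    \sum_(p <- S) rest p + \sum_(p <- S) main p.
  rewrite -big_split /= big_seq [RHS]big_seq; apply: eq_bigr => p pinS.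
  rewrite (bigID (fun m => (p %| m)%N)) /=; congr (_ + _).
  rewrite big_nat_cond [RHS]big_nat_cond; apply: eq_bigr => m /andP[/andP[m0 _] pm].
  rewrite omega_mul // wC fmul ?(S0 p pinS) //.
  by rewrite prime_coprime // (allP pS).
have Hrest : cmod (\sum_(p <- S) rest p) <= X * (A * B).
  apply: le_trans (cmod_sum _ _ _) _.
  apply: (@le_trans _ _ (\sum_(p <- S) (X * B) * (p%:R^-1) ^+ 2)).
    rewrite big_seq [leRHS]big_seq; apply: ler_sum => p pinS.
    have p0 := S0 p pinS.
    apply: le_trans (cmod_sum _ _ _) _.
    apply: (@le_trans _ _ (\sum_(1 <= m < (N %/ p).+1) (p %| m)%:R * B)).
      rewrite big_mkcond big_nat [leRHS]big_nat; apply: ler_sum => m /andP[m0 _].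
      case: ifP => pm; last by rewrite mul0r.
      have pm0 : (0 < p * m)%N by rewrite muln_gt0 p0.
      rewrite mul1r !cmodM cmodV cmod_nat -[B]mulr1 ler_pM ?mulr_ge0 ?cmod_ge0 ?invr_ge0 //.
        by rewrite -[B]mul1r ler_pM ?cmod_ge0 ?f1 ?FB.
      have o0 := omega_gt0 pinS (dvdn_mulr m (dvdnn p)).
      by rewrite invf_le1 ?ltr0n // ler1n.
    rewrite -mulr_suml; apply: (@le_trans _ _ ((N %/ p)%:R / p%:R * B)).
      by rewrite ler_wpM2r // sum_dvdn.
    have -> : X * B * p%:R^-1 ^+ 2 = X / p%:R / p%:R * B by ring.
    rewrite ler_wpM2r // ler_wpM2r ?invr_ge0 // ler_pdivlMr ?ltr0n //.
    by rewrite (le_trans _ NX) // -natrM ler_nat leq_divM.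
  rewrite -mulr_sumr mulrA (mulrAC X A B) ler_wpM2l ?mulr_ge0 ?(ltW X0) //.
  exact: le_trans (sum_inv_sqr _ uS y2 Sy) yA.
have Hmain : cmod (\sum_(p <- S) main p) <= X * W * (4 * A * B + 2 * L * b).
  rewrite -(sum_dyadic (T := T)); last by move=> p pinS; rewrite S0 ?ST.
  apply: le_trans (cmod_sum _ _ _) _.
  have y0 : (0 < y)%N by apply: leq_trans y2.
  have XW : 0 <= X * W by rewrite mulr_ge0 // ltW.
  apply: le_trans (ler_wpM2l XW
    (dyadic_total uS y0 Sy (erefl L) A0 B0 b0 yA2)).
  rewrite mulr_sumr; apply: ler_sum => k _.
  (* A member of the block gives 2^k <= T and 2 <= T; together with T^10 <= N this yields the
     condition 2 T^8 <= N / 2^k of [weight_sum]. *)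
  have [E|[p0 p0k]] : dyadic S k = [::] \/ exists p, p \in dyadic S k.
    by case: (dyadic S k) => [|p s]; [left|right; exists p; rewrite mem_head].
    by rewrite E big_nil cmod0 sqrtr0 !mul0r addr0 mulr0 mulr0.
  have k2 : (0 < 2 ^ k)%N by rewrite expn_gt0.
  have -> : X * W * ((2 ^ k)%:R^-1 * (Num.sqrt (size (dyadic S k))%:R * B + (size (dyadic S k))%:R * b))
    = X / (2 ^ k)%:R * W * (Num.sqrt (size (dyadic S k))%:R * B + (size (dyadic S k))%:R * b).
    by ring.
  have sub p : p \in dyadic S k -> p \in S by move=> /(mem_dyadic S0)[].
  apply: block_bound => //.
  - exact: filter_uniq.
  - by apply/allP => p /sub/(allP pS).
  - by move=> p /(mem_dyadic S0)[_ /andP[]].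
  - have [p0S /andP[kp0 _]] := mem_dyadic S0 p0k.
    have kT := leq_trans kp0 (ST p0 p0S).
    have T2 : (1 < T)%N := leq_trans (prime_gt1 (allP pS p0 p0S)) (ST p0 p0S).
    apply: le_trans (hW _ _) _.
      rewrite leq_divRL // (leq_trans _ TN) //.
      rewrite (_ : (T ^ 10 = T * T ^ 8 * T)%N) ?leq_mul //.
      by rewrite -expnS -expnSr.
    rewrite ler_wpM2r ?sqr_ge0 // ler_pdivlMr ?ltr0n //.
    by rewrite (le_trans _ NX) // -natrM ler_nat leq_divM.
  by move=> p p' /sub pinS /sub p'inS; exact: off.
apply: le_trans (cmodD _ _) _; apply: lerD.
  apply: le_trans (cmod_sum _ _ _) _.
  rewrite big_nat_cond [leRHS]big_nat_cond; apply: ler_sum => n /andP[/andP[n0 _] _].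
  by rewrite cmodM ler_piMl ?cmod_ge0 ?f1.
apply: le_trans (cmodD _ _) _.
apply: le_trans (lerD Hrest Hmain) _.
(* Since W and W L are at most 20, the constants are 81 = 1 + 4 * 20 and 40 = 2 * 20. *)
rewrite -mulrA -mulrDr ler_pM2l //.
have AB : 0 <= A * B by rewrite mulr_ge0.
have := ler_wpM2r AB W20; have := ler_wpM2r b0 WL; lra.
Qed.

(** * From finite sums to the averages and suprema of the statement *)

Lemma coprime_prime_prod (R : realType) (Y Z : R) (n : nat) :
  coprime n (prime_prod Y Z) =
  (omega [seq p <- index_iota 0 (Num.truncn Z).+1 | prime p && (Y <= p%:R < Z)] n == 0%N).
Proof.
rewrite /prime_prod (big_morph (coprime n) (coprimeMr n) (coprimen1 n)) big_andE.
rewrite -leqn0 leqNgt -has_count; apply/idP/idP => [/forall_inP H|/hasPn H].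
  apply/hasPn => p; rewrite mem_filter mem_index_iota => /andP[/andP[pp pY] /andP[_ pT]].
  by rewrite -prime_coprime // coprime_sym; apply: (H (Ordinal pT)); rewrite pp pY.
apply/forall_inP => p /andP[pp pY]; rewrite coprime_sym prime_coprime //; apply: H.
by rewrite mem_filter mem_index_iota pp pY /= ltn_ord.
Qed.

Lemma truncn_divn (R : realType) (X : R) (p : nat) : 0 <= X -> (0 < p)%N ->
  Num.truncn (X / p%:R) = (Num.truncn X %/ p)%N.
Proof.
move=> X0 p0; have /andP[NX XN] := truncn_itv X0; apply: truncn_def.
rewrite ler_pdivlMr ?ltr0n // ltr_pdivrMr ?ltr0n // -!natrM.
rewrite (le_trans _ NX) ?ler_nat ?leq_divM //=.
by rewrite (lt_le_trans XN) // ler_nat ltn_ceil.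
Qed.

(** The supremum is tested on the interval [0, X/p'], whose integer points are those up to N / p'.
    It is long enough because p' < Z < 10 Y Z. *)
Lemma bilinear_avg_le (R : realType) (F : nat -> R[i]) (X Y Z b : R) (p p' : nat) :
  0 < X -> 1 < Y -> 0 < Z ->
  (forall r : \bar R, bilinear_avgs X Y Z F r -> (r <= (b ^+ 2)%:E)%E) ->
  prime p -> prime p' -> Y <= p%:R -> p'%:R < Z -> (p < p')%N ->
  cmod (\sum_(1 <= m < (Num.truncn X %/ p').+1 | coprime m (p * p')%N)
      F (p * m)%N * (F (p' * m)%N)^*) <= X / p'%:R * b ^+ 2.
Proof.
move=> X0 Y1 Z0 H pp pp' Yp p'Z pp1.
have p'0 : 0 < p'%:R :> R by rewrite ltr0n prime_gt0.
have p'1 : 1 <= p'%:R :> R by rewrite ler1n prime_gt0.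
pose M := X / p'%:R; have M0 : 0 < M by rewrite divr_gt0.
have MX : M <= X by rewrite ler_pdivrMr // ler_peMr // ltW.
pose I : set R := `[0, M]%classic.
have /H : bilinear_avgs X Y Z F (bilinear_avg F p p' I M)%:E.
  exists p, p', I, M; split; first by split.
  split=> //; split.
  - exact: interval_is_interval.
  - by move=> x; rewrite /I /= !in_itv /= => /andP[-> /le_trans]; apply.
  - by rewrite /I /= in_itv /= lexx ltW.
  - by move=> x; rewrite /I /= in_itv /= => /andP[].
  - rewrite /M ltr_pM2l // ltf_pV2 ?posrE ?mulr_gt0 //; last lra.
    nra.
rewrite lee_fin /bilinear_avg -ler_pdivlMl ?invr_gt0 // invrK.
rewrite truncn_divn ?(ltW X0) ?prime_gt0 //.
rewrite big_nat_cond [in X in X -> _](eq_bigl (fun m => (0 < m < (Num.truncn X %/ p').+1)%N && coprime m (p * p'))).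
  by rewrite -big_nat_cond.
move=> m; case: (boolP (0 < m < _)%N) => //= /andP[_ mM].
rewrite /I mem_set //= in_itv /= ler0n /= /M ler_pdivlMr // -natrM.
have /andP[NX _] := truncn_itv (ltW X0); apply: le_trans NX.
by rewrite ler_nat -leq_divRL ?prime_gt0.
Qed.

(** The estimate in real numbers, for finite bounds [B] on |F| and [b ^+ 2] on the bilinear
    averages. *)
Lemma avg_multiplicative_le (R : realType) (F f : nat -> R[i]) (X Y Z B b : R) :
  1 < Y -> Y < Z -> Z < X `^ (1 / 16) -> 0 <= B -> 0 <= b ->
  multiplicative_fun f ->
  (forall n : nat, (0 < n)%N -> cmod (f n) <= 1) ->
  (forall n : nat, (0 < n)%N -> cmod (F n) <= B) ->
  (forall r : \bar R, bilinear_avgs X Y Z F r -> (r <= (b ^+ 2)%:E)%E) ->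
  cmod (avg X (fun n => f n * F n)) <=
  1000 * (Y `^ (- (1 / 2)) * B + E_sieve X Y Z F + b).
Proof.
move=> Y1 YZ ZX B0 b0 fmul f1 FB bil.
have Z1 : 1 < Z by exact: lt_trans YZ.
have X0 : 0 < X.
  (* For X <= 0 the convention on [ln] and [powR] makes the power of X at most 1, against Z > 1. *)
  rewrite ltNge; apply/negP => X0.
  by move: ZX; rewrite /powR (ln0 X0) mulr0 expR0; case: ifP => _; [case: (_ == 0)|]; rewrite ?mulr1n ?mulr0n; lra.
have ZX16 : Z ^+ 16 <= X.
  have : Z ^+ 16 < (X `^ (1 / 16)) ^+ 16 by rewrite ltrXn2r // ltW // (lt_trans ltr01).
  by rewrite -[in X in _ < X]powR_mulrn ?powR_ge0 // -powRrM mul1r mulVf // powRr1 ?(ltW X0) // => /ltW.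
have X1 : 1 <= X by rewrite (le_trans _ ZX16) // exprn_ege1 // ltW.
pose N := Num.truncn X; have /andP[NX XN] := truncn_itv (ltW X0).
rewrite -/N in NX XN.
have N1 : 1 <= N%:R :> R by rewrite ler1n truncn_gt0.
have X2N : X <= 2 * N%:R by move: XN; rewrite -natr1; lra.
pose T := Num.truncn Z; have /andP[TZ ZT] := truncn_itv (ltW (lt_trans ltr01 Z1)).
have TN : (T ^ 10 <= N)%N.
  rewrite truncn_ge_nat ?(ltW X0) // natrX (le_trans _ ZX16) //.
  apply: (@le_trans _ _ (Z ^+ 10)); first by rewrite lerXn2r ?nnegrE //; lra.
  by rewrite ler_weXn2l // ltW.
(* An integer lower bound for the primes that is at least 2, as [sum_inv_sqr] requires. From Y <= 2
   y one gets 2/y <= 4/Y, so A = 4 Y^(-1/2) dominates 2/y both by itself and by its square. *)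
pose y := maxn 2 (Num.truncn Y).
have /andP[tY Yt] := truncn_itv (ltW (lt_trans ltr01 Y1)).
have Yy : Y <= 2 * y%:R.
  apply: le_trans (ltW Yt) _; rewrite -natrM ler_nat /y.
  by rewrite -addn1 mul2n -addnn leq_add ?leq_maxr // (leq_trans _ (leq_maxl _ _)).
set a := Y `^ _.
have Y0 : 0 < Y by lra.
have a0 : 0 < a by rewrite powR_gt0.
have a2 : a ^+ 2 = Y^-1.
  by rewrite /a powRN div1r powR12_sqrt ?ltW // exprVn sqr_sqrtr // ltW.
have Yi1 : Y^-1 < 1 by rewrite invf_lt1.
have aa : Y^-1 <= a by rewrite -a2; nra.
have y0 : 0 < y%:R :> R by rewrite ltr0n (leq_trans _ (leq_maxl _ _)).
have yY : 2 / y%:R <= 4 * Y^-1.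
  rewrite ler_pdivrMr // mulrAC ler_pdivlMr //; lra.
pose S := [seq p <- index_iota 0 T.+1 | prime p && (Y <= p%:R < Z)].
have inS p : p \in S -> [/\ prime p, Y <= p%:R & p%:R < Z].
  by rewrite mem_filter => /andP[/andP[pp /andP[]]].
have := @sum_multiplicative_le R S T y N X (4 * a) B b f F.
have -> : \sum_(1 <= n < N.+1 | omega S n == 0%N) cmod (F n) = N%:R * E_sieve X Y Z F.
  rewrite /E_sieve /avg -/N mulrA divff ?mul1r; last by rewrite gt_eqF //; lra.
  rewrite big_mkcond; apply: eq_bigr => n _.
  by rewrite coprime_prime_prod -/T -/S; case: ifP => _; rewrite ?mulr1 ?mulr0.
move=> H; rewrite /avg -/N cmodM cmodV cmod_nat mulrC ler_pdivrMr; last lra.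
apply: (le_trans (H _ _ _ _ _ _ _ _ _ _ _ _ _ _ _ _)) => //.
- by rewrite filter_uniq // iota_uniq.
- by apply/allP => p /inS[].
- move=> p /inS[pp Yp pZ]; rewrite /y geq_max prime_gt1 //=.
  rewrite -(ler_nat R) (le_trans tY Yp) /=.
  by rewrite /T truncn_ge_nat ?ltW //; lra.
- exact: leq_maxl.
- by rewrite mulr_ge0 // ltW.
- by apply: le_trans yY _; lra.
- by apply: le_trans yY _; rewrite exprMn a2; have : 0 < Y^-1 by [rewrite invr_gt0]; lra.
- move=> p p' /inS[pp Yp pZ] /inS[pp' Yp' p'Z] lt.
  by apply: (bilinear_avg_le X0 Y1 _ bil) => //; lra.
have aB : 0 <= a * B by rewrite mulr_ge0 // ltW.
have Es0 : 0 <= E_sieve X Y Z F.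
  rewrite /E_sieve /avg mulr_ge0 ?invr_ge0 ?sumr_ge0 // => n _.
  by rewrite mulr_ge0 ?cmod_ge0.
(* Dividing by N instead of X costs a factor 2, so the final coefficients are 648, 1 and 80. *)
have h1 : X * (81 * (4 * a) * B + 40 * b) <= 2 * N%:R * (324 * (a * B) + 40 * b).
  rewrite (_ : 81 * (4 * a) * B = 324 * (a * B)); last by rewrite !mulrA -natrM.
  have k0 : 0 <= 324 * (a * B) + 40 * b by lra.
  exact: ler_wpM2r k0 _ _ X2N.
apply: le_trans (lerD (lexx _) h1) _.
have N0 : 0 <= N%:R :> R by [].
have := mulr_ge0 N0 Es0; have := mulr_ge0 N0 aB; have := mulr_ge0 N0 b0; lra.
Qed.

Theorem proposition2p2 (R : realType) :
  exists C : R,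
    forall (F : nat -> R[i]) (X Y Z : R) (f : nat -> R[i]),
      1 < Y -> Y < Z -> Z < X `^ (1 / 16) ->
      2 <= ln Z / ln Y ->
      multiplicative_fun f ->
      (forall n : nat, (0 < n)%N -> cmod (f n) <= 1) ->
      ((cmod (avg X (fun n => f n * F n)))%:E <=
       C%:E * (E_triv Y F + (E_sieve X Y Z F)%:E + E_bilinear X Y Z F))%E.
Proof.
have [C C0 CE] : exists2 C : R, 0 < C & C = 1000 by exists 1000; rewrite ?ltr0n.
exists C => F X Y Z f Y1 YZ ZX _ fmul f1.
have a0 : 0 < Y `^ (- (1 / 2)) by rewrite powR_gt0 // (lt_trans ltr01).
have supF n : (0 < n)%N -> ((cmod (F n))%:E <= sup_norm F)%E.
  by move=> n0; apply: ereal_sup_ubound; exists n.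
(* An infinite [sup_norm] or an infinite bilinear supremum makes the right side infinite; the real
   estimate covers the other cases. *)
rewrite /E_triv; case E : (sup_norm F) supF => [B| |] supF.
- have FB n : (0 < n)%N -> cmod (F n) <= B by move=> /supF; rewrite lee_fin.
  have B0 : 0 <= B by exact: le_trans (cmod_ge0 _) (FB 1%N _).
  rewrite /E_bilinear; have bil r : bilinear_avgs X Y Z F r ->
      (r <= ereal_sup (bilinear_avgs X Y Z F))%E by exact: ereal_sup_ubound.
  have main b : 0 <= b -> (forall r, bilinear_avgs X Y Z F r -> (r <= (b ^+ 2)%:E)%E) ->
      ((cmod (avg X (fun n => f n * F n)))%:E <= C%:E *
      ((Y `^ (- (1 / 2)))%:E * B%:E + (E_sieve X Y Z F)%:E + b%:E))%E.
    by move=> b0 bb; rewrite lee_fin CE; exact: avg_multiplicative_le.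
  case: ereal_sup bil => [r0| |] bil /=.
  (* Here b = sqrt r0; for negative r0 the root is 0, whose square still bounds the averages. *)
  + apply: main; first exact: sqrtr_ge0.
    move=> r hr; have hr0 := bil r hr; apply: le_trans hr0 _; rewrite lee_fin.
    have [r00|r00] := leP 0 r0; first by rewrite sqr_sqrtr.
    by rewrite (le_trans (ltW r00)) // sqr_ge0.
  + by rewrite addey // gt0_muley ?leey // lte_fin.
  (* The supremum is -oo, which [sqrte] sends to 0, so b = 0. *)
  + apply: main => // r /bil; rewrite leeNy_eq => /eqP ->; exact: leNye.
(* The trivial term is +oo since the power of Y is positive, and the bilinear term is nonnegative,
   so the sum stays +oo. *)
- rewrite gt0_muley ?lte_fin // addye; last first.
    by rewrite gt_eqF // (lt_le_trans _ (sqrte_ge0 _)) // ltNy0.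
  by rewrite gt0_muley ?leey // lte_fin.
- by have := supF 1%N isT; rewrite leeNy_eq.
Qed.
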